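(* Let $A$ be a profinite MV-algebra, so $A\cong\prod_{x\in X}\L_{n_x}$ for some set $X$ and integers $n_x\ge2$, and let $\eta(A):=\{n_x:x\in X\}$. Suppose there exists $n_0\in\eta(A)$ such that $n_0-1$ divides all but finitely many $n\in\eta(A)$. Then there exists an MV-algebra $B$ such that $A\cong\widehat B$.
   Context: A profinite MV-algebra is an inverse limit of finite MV-algebras; every such algebra is isomorphic to a product $\prod_{x\in X}\L_{n_x}$, and the set $\eta(A)$ is uniquely determined by $A$. Here $\L_n=\{0,\frac1{n-1},\ldots,1\}$ is the $n$-element Łukasiewicz chain. $\widehat B$ denotes the profinite completion of $B$: the inverse limit of its finite quotients $B/I$ ($I$ an ideal with $B/I$ finite), directed by reverse inclusion, with natural quotient maps. *)

(* Defs.v *)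
From HB Require Import structures.
From mathcomp Require Import all_boot all_order all_algebra.
From mathcomp Require Import mathcomp_extra boolp classical_sets functions.
From mathcomp Require Import cardinality.
From mathcomp Require Import lra.

Set Implicit Arguments.
Unset Strict Implicit.
Unset Printing Implicit Defensive.

Import Order.TTheory GRing.Theory Num.Theory.

Declare Scope mv_scope.
Delimit Scope mv_scope with MV.
Local Open Scope mv_scope.
Local Open Scope quotient_scope.
Local Open Scope classical_set_scope.

(* Chang's axioms; the trivial algebra (0 = 1) is allowed. *)
HB.mixin Record isMVAlgebra T := {
  mv0 : T;
  mvadd : T -> T -> T;
  mvneg : T -> T;
  mvaddA : associative mvadd;
  mvaddC : commutative mvadd;
  mvadd0 : right_id mv0 mvadd;
  mvnegK : involutive mvneg;
  mvadd1 : forall x, mvadd x (mvneg mv0) = mvneg mv0;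
  mvmaxC : forall x y, mvadd (mvneg (mvadd (mvneg x) y)) y =
                       mvadd (mvneg (mvadd (mvneg y) x)) x
}.

#[short(type="mvAlgType")]
HB.structure Definition MVAlgebra := {T of isMVAlgebra T}.

Notation "x ⊕ y" := (mvadd x y) (at level 50, left associativity) : mv_scope.
Notation "¬ x" := (mvneg x) (at level 35, right associativity) : mv_scope.

Definition mvsub (A : mvAlgType) (x y : A) : A := ¬ (¬ x ⊕ y).
Notation "x ⊖ y" := (mvsub x y) (at level 50, left associativity) : mv_scope.

Definition mvle (A : mvAlgType) (x y : A) : Prop := ¬ x ⊕ y = ¬ mv0.
Notation "x ≤ y" := (mvle x y) (at level 70) : mv_scope.

Definition mvdist (A : mvAlgType) (x y : A) : A := (x ⊖ y) ⊕ (y ⊖ x).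

Section MVTheory.
Variable A : mvAlgType.
Implicit Types x y z w : A.

Lemma mvadd0l x : mv0 ⊕ x = x. Proof. by rewrite mvaddC mvadd0. Qed.

Lemma mvadd1l x : ¬ mv0 ⊕ x = ¬ mv0. Proof. by rewrite mvaddC mvadd1. Qed.

Lemma mvaddN x : ¬ x ⊕ x = ¬ mv0.
Proof.
by have := mvmaxC x (¬ mv0); rewrite mvnegK mvadd0l mvadd1 => <-.
Qed.

Lemma mvsubxx x : x ⊖ x = mv0. Proof. by rewrite /mvsub mvaddN mvnegK. Qed.

Lemma mvle_addr x w : x ≤ x ⊕ w.
Proof. by rewrite /mvle mvaddA mvaddN mvadd1l. Qed.

Lemma mvsubK x y : x ≤ y -> (y ⊖ x) ⊕ x = y.
Proof. by move=> h; rewrite /mvsub mvmaxC h mvnegK mvadd0l. Qed.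

Lemma mvleP x y : x ≤ y <-> exists w, y = x ⊕ w.
Proof.
split=> [h|[w ->]]; last exact: mvle_addr.
by exists (y ⊖ x); rewrite mvaddC mvsubK.
Qed.

Lemma mvle_trans y x z : x ≤ y -> y ≤ z -> x ≤ z.
Proof.
by move=> /mvleP[u ->] /mvleP[v ->]; apply/mvleP; exists (u ⊕ v); rewrite mvaddA.
Qed.

Lemma mvle_add2r z x y : x ≤ y -> x ⊕ z ≤ y ⊕ z.
Proof.
move=> /mvleP[u ->]; apply/mvleP; exists u.
by rewrite -!mvaddA [u ⊕ z]mvaddC.
Qed.

Lemma mvle_add x y z w : x ≤ y -> z ≤ w -> x ⊕ z ≤ y ⊕ w.
Proof.
move=> xy zw; apply: (mvle_trans (mvle_add2r z xy)).
by rewrite mvaddC [y ⊕ w]mvaddC; exact: mvle_add2r.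
Qed.

Lemma mvle_subl x y w : x ⊖ y ≤ w <-> x ≤ y ⊕ w.
Proof. by rewrite /mvle /mvsub mvnegK mvaddA. Qed.

Lemma mvle_sub_add x y : x ≤ y ⊕ (x ⊖ y).
Proof.
by apply/mvle_subl; rewrite -[leRHS in _ ≤ leRHS]mvadd0; exact: mvle_addr.
Qed.

Lemma mvsub_trans y x z : x ⊖ z ≤ (x ⊖ y) ⊕ (y ⊖ z).
Proof.
apply/mvle_subl; apply: (mvle_trans (mvle_sub_add x y)).
rewrite [(x ⊖ y) ⊕ _]mvaddC mvaddA; apply: mvle_add2r; exact: mvle_sub_add.
Qed.

Lemma mvsub_add x y z w : (x ⊕ z) ⊖ (y ⊕ w) ≤ (x ⊖ y) ⊕ (z ⊖ w).
Proof.
apply/mvle_subl.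
have -> : y ⊕ w ⊕ ((x ⊖ y) ⊕ (z ⊖ w)) = (y ⊕ (x ⊖ y)) ⊕ (w ⊕ (z ⊖ w)).
  by rewrite -!mvaddA; congr (_ ⊕ _); rewrite !mvaddA [w ⊕ _]mvaddC.
by apply: mvle_add; exact: mvle_sub_add.
Qed.

Lemma mvsubNN x y : ¬ x ⊖ ¬ y = y ⊖ x.
Proof. by rewrite /mvsub mvnegK mvaddC. Qed.

Lemma mvdistxx x : mvdist x x = mv0.
Proof. by rewrite /mvdist mvsubxx mvadd0. Qed.

Lemma mvdistC x y : mvdist x y = mvdist y x.
Proof. by rewrite /mvdist mvaddC. Qed.

Lemma mvdistNN x y : mvdist (¬ x) (¬ y) = mvdist x y.
Proof. by rewrite /mvdist !mvsubNN mvaddC. Qed.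

Lemma mvaddACA x y z w : (x ⊕ y) ⊕ (z ⊕ w) = (x ⊕ z) ⊕ (y ⊕ w).
Proof. by rewrite -!mvaddA; congr (_ ⊕ _); rewrite !mvaddA [y ⊕ _]mvaddC. Qed.

Lemma mvdist_trans y x z : mvdist x z ≤ mvdist x y ⊕ mvdist y z.
Proof.
rewrite /mvdist mvaddACA [(y ⊖ x) ⊕ _]mvaddC.
by apply: mvle_add; exact: mvsub_trans.
Qed.

Lemma mvdist_add x y z w : mvdist (x ⊕ z) (y ⊕ w) ≤ mvdist x y ⊕ mvdist z w.
Proof. by rewrite /mvdist mvaddACA; apply: mvle_add; exact: mvsub_add. Qed.

End MVTheory.

Definition mv_morphism (A B : mvAlgType) (f : A -> B) : Prop :=
  [/\ f mv0 = mv0,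
      forall x y, f (x ⊕ y) = f x ⊕ f y
    & forall x, f (¬ x) = ¬ f x].

Definition mv_iso (A B : mvAlgType) : Prop :=
  exists2 f : A -> B, mv_morphism f & bijective f.

Notation "A ≅ B" := (mv_iso A B) (at level 70) : mv_scope.

Definition mv_finite (A : mvAlgType) : Prop := finite_set [set: A].

Section Lukasiewicz.
Local Open Scope ring_scope.

Definition luk_carrier (n : nat) : seq rat :=
  [seq k%:R / n.-1%:R | k <- iota 0 n].

(* The proof that n >= 2 is a parameter: luk_carrier n is not closed under
   x |-> 1 - x when n <= 1. *)
Definition luk (n : nat) (n_ge2 : (2 <= n)%N) : Type :=
  {q : rat | q \in luk_carrier n}.

Variables (n : nat) (n_ge2 : (2 <= n)%N).

Let L := luk n_ge2.

Lemma luk_carrierP q :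
  reflect (exists2 k, (k <= n.-1)%N & q = k%:R / n.-1%:R) (q \in luk_carrier n).
Proof.
have n1 : n = n.-1.+1 by case: n n_ge2.
apply: (iffP mapP) => -[k kn ->]; exists k => //; move: kn.
  by rewrite mem_iota /= add0n {1}n1 ltnS.
by rewrite mem_iota /= add0n {2}n1 ltnS.
Qed.

Let n1_neq0 : n.-1%:R != 0 :> rat.
Proof. by rewrite pnatr_eq0; case: n n_ge2 => [|[]]. Qed.

Let n1_gt0 : 0 < n.-1%:R :> rat.
Proof. by rewrite ltr0n; case: n n_ge2 => [|[]]. Qed.

Lemma luk_carrier0 : 0 \in luk_carrier n.
Proof. by apply/luk_carrierP; exists 0%N => //; rewrite mul0r. Qed.

Lemma luk_carrierN q : q \in luk_carrier n -> 1 - q \in luk_carrier n.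
Proof.
move=> /luk_carrierP[k kn ->]; apply/luk_carrierP; exists (n.-1 - k)%N.
  exact: leq_subr.
by rewrite natrB // mulrBl divff.
Qed.

Lemma luk_carrier1 : 1 \in luk_carrier n.
Proof. by rewrite -[1]subr0; exact: luk_carrierN luk_carrier0. Qed.

Lemma luk_carrierD p q : p \in luk_carrier n -> q \in luk_carrier n ->
  Num.min 1 (p + q) \in luk_carrier n.
Proof.
move=> /luk_carrierP[k kn ->] /luk_carrierP[l ln ->].
rewrite -mulrDl -natrD minEle; case: ifP => [_|]; first exact: luk_carrier1.
rewrite ler_pdivlMr // mul1r ler_nat => /negbT; rewrite -ltnNge => /ltnW h.
by apply/luk_carrierP; exists (k + l)%N.
Qed.

Lemma luk_carrier_itv q : q \in luk_carrier n -> 0 <= q <= 1.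
Proof.
move=> /luk_carrierP[k kn ->].
by rewrite divr_ge0 ?ler0n //= ler_pdivrMr // mul1r ler_nat.
Qed.

Definition luk0 : L := exist _ 0 luk_carrier0.
Definition luk_neg (x : L) : L := exist _ (1 - val x) (luk_carrierN (valP x)).
Definition luk_add (x y : L) : L :=
  exist _ (Num.min 1 (val x + val y)) (luk_carrierD (valP x) (valP y)).

Let luk_itv (x : L) : 0 <= val x <= 1.
Proof. exact/luk_carrier_itv/valP. Qed.

Lemma luk_addA : associative luk_add.
Proof.
have H (a b c : rat) : 0 <= a <= 1 -> 0 <= b <= 1 -> 0 <= c <= 1 ->
    Num.min 1 (a + Num.min 1 (b + c)) = Num.min 1 (Num.min 1 (a + b) + c).
  move=> /andP[? ?] /andP[? ?] /andP[? ?].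
  by case: (leP 1 (b + c)) => ?; case: (leP 1 (a + b)) => ?;
    do ![case: leP => ?]; lra.
by move=> x y z; apply: val_inj; apply: H; exact: luk_itv.
Qed.

Lemma luk_addC : commutative luk_add.
Proof. by move=> x y; apply: val_inj; rewrite /= addrC. Qed.

Lemma luk_addx0 : right_id luk0 luk_add.
Proof.
move=> x; apply: val_inj; rewrite /= addr0.
by have /andP[_ ?] := luk_itv x; apply/min_idPr.
Qed.

Lemma luk_negK : involutive luk_neg.
Proof. by move=> x; apply: val_inj; rewrite /= subKr. Qed.

Lemma luk_addx1 x : luk_add x (luk_neg luk0) = luk_neg luk0.
Proof.
apply: val_inj; rewrite /= subr0; apply/min_idPl.
by have /andP[? _] := luk_itv x; rewrite lerDr.
Qed.

Lemma luk_maxC x y : luk_add (luk_neg (luk_add (luk_neg x) y)) y =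
                     luk_add (luk_neg (luk_add (luk_neg y) x)) x.
Proof.
have H (a b : rat) : 0 <= a <= 1 -> 0 <= b <= 1 ->
    Num.min 1 (1 - Num.min 1 (1 - a + b) + b) =
    Num.min 1 (1 - Num.min 1 (1 - b + a) + a).
  move=> /andP[? ?] /andP[? ?].
  by case: (leP 1 (1 - a + b)) => ?; case: (leP 1 (1 - b + a)) => ?;
    do ![case: leP => ?]; lra.
by apply: val_inj; apply: H; exact: luk_itv.
Qed.

HB.instance Definition _ := isMVAlgebra.Build (luk n_ge2)
  luk_addA luk_addC luk_addx0 luk_negK luk_addx1 luk_maxC.

End Lukasiewicz.

Definition mv_prod (X : Type) (A : X -> mvAlgType) : Type := forall x, A x.

Section Product.
Variables (X : Type) (A : X -> mvAlgType).
Let P := mv_prod A.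

Definition prod0 : P := fun=> mv0.
Definition prod_add (f g : P) : P := fun x => f x ⊕ g x.
Definition prod_neg (f : P) : P := fun x => ¬ f x.

Lemma prod_addA : associative prod_add.
Proof. by move=> f g h; apply: functional_extensionality_dep => x; exact: mvaddA. Qed.
Lemma prod_addC : commutative prod_add.
Proof. by move=> f g; apply: functional_extensionality_dep => x; exact: mvaddC. Qed.
Lemma prod_addx0 : right_id prod0 prod_add.
Proof. by move=> f; apply: functional_extensionality_dep => x; exact: mvadd0. Qed.
Lemma prod_negK : involutive prod_neg.
Proof. by move=> f; apply: functional_extensionality_dep => x; exact: mvnegK. Qed.
Lemma prod_addx1 f : prod_add f (prod_neg prod0) = prod_neg prod0.
Proof. by apply: functional_extensionality_dep => x; exact: mvadd1. Qed.
Lemma prod_maxC f g : prod_add (prod_neg (prod_add (prod_neg f) g)) g =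
                      prod_add (prod_neg (prod_add (prod_neg g) f)) f.
Proof. by apply: functional_extensionality_dep => x; exact: mvmaxC. Qed.

HB.instance Definition _ := isMVAlgebra.Build (mv_prod A)
  prod_addA prod_addC prod_addx0 prod_negK prod_addx1 prod_maxC.

End Product.

(* If A ≅ mv_prod (fun x => luk (n_ge2 x)), then eta_set n is the set η(A). *)
Definition eta_set (X : Type) (n : X -> nat) : set nat := range n.

Record inverse_system := InverseSystem {
  is_index : Type;
  is_le : is_index -> is_index -> Prop;
  is_refl : forall i, is_le i i;
  is_trans : forall i j k, is_le i j -> is_le j k -> is_le i k;
  is_inhab : inhabited is_index;
  is_directed : forall i j, exists2 k, is_le i k & is_le j k;
  is_obj : is_index -> mvAlgType;
  is_map : forall i j, is_le i j -> is_obj j -> is_obj i;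
  is_map_morph : forall i j (ij : is_le i j), mv_morphism (is_map ij);
  is_map_id : forall i (ii : is_le i i) x, is_map ii x = x;
  is_map_comp : forall i j k (ij : is_le i j) (jk : is_le j k)
    (ik : is_le i k) x, is_map ij (is_map jk x) = is_map ik x
}.

Section InverseLimit.
Variable S : inverse_system.

Definition coherent (f : mv_prod (@is_obj S)) : Prop :=
  forall i j (ij : is_le i j), is_map ij (f j) = f i.

Definition inverse_limit : Type := {f : mv_prod (@is_obj S) | coherent f}.

Lemma coherent0 : coherent mv0.
Proof. by move=> i j ij; case: (is_map_morph ij). Qed.

Lemma coherentD f g : coherent f -> coherent g -> coherent (f ⊕ g).
Proof.
move=> cf cg i j ij; case: (is_map_morph ij) => _ mD _.
by rewrite mD cf cg.
Qed.

Lemma coherentN f : coherent f -> coherent (¬ f).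
Proof.
by move=> cf i j ij; case: (is_map_morph ij) => _ _ mN; rewrite mN cf.
Qed.

Definition lim0 : inverse_limit := exist _ _ coherent0.
Definition lim_add (f g : inverse_limit) : inverse_limit :=
  exist _ _ (coherentD (proj2_sig f) (proj2_sig g)).
Definition lim_neg (f : inverse_limit) : inverse_limit :=
  exist _ _ (coherentN (proj2_sig f)).

Lemma lim_inj (f g : inverse_limit) : proj1_sig f = proj1_sig g -> f = g.
Proof.
case: f g => [f cf] [g cg] /= fg; case: g / fg cg => cg.
by congr exist; exact: Prop_irrelevance.
Qed.

Lemma lim_addA : associative lim_add.
Proof. by move=> f g h; apply: lim_inj; exact: mvaddA. Qed.
Lemma lim_addC : commutative lim_add.
Proof. by move=> f g; apply: lim_inj; exact: mvaddC. Qed.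
Lemma lim_addx0 : right_id lim0 lim_add.
Proof. by move=> f; apply: lim_inj; exact: mvadd0. Qed.
Lemma lim_negK : involutive lim_neg.
Proof. by move=> f; apply: lim_inj; exact: mvnegK. Qed.
Lemma lim_addx1 f : lim_add f (lim_neg lim0) = lim_neg lim0.
Proof. by apply: lim_inj; exact: mvadd1. Qed.
Lemma lim_maxC f g : lim_add (lim_neg (lim_add (lim_neg f) g)) g =
                     lim_add (lim_neg (lim_add (lim_neg g) f)) f.
Proof. by apply: lim_inj; exact: mvmaxC. Qed.

HB.instance Definition _ := isMVAlgebra.Build inverse_limit
  lim_addA lim_addC lim_addx0 lim_negK lim_addx1 lim_maxC.

End InverseLimit.

Definition profinite (A : mvAlgType) : Prop :=
  exists2 S : inverse_system,
    (forall i : is_index S, mv_finite (is_obj i)) & A ≅ inverse_limit S.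

Record mv_ideal (B : mvAlgType) := MVIdeal {
  ideal_set :> set B;
  ideal0 : ideal_set mv0;
  idealD : forall x y, ideal_set x -> ideal_set y -> ideal_set (x ⊕ y);
  ideal_down : forall x y, x ≤ y -> ideal_set y -> ideal_set x
}.

Section Quotient.
Variables (B : mvAlgType) (I : mv_ideal B).

Definition ideal_rel : rel {classic B} := fun x y => `[< ideal_set I (mvdist x y) >].

Lemma ideal_rel_equiv : equiv_class_of ideal_rel.
Proof.
split=> [x|x y|y x z].
- by apply/asboolP; rewrite mvdistxx; exact: ideal0.
- by rewrite /ideal_rel mvdistC.
- move=> /asboolP xy /asboolP yz; apply/asboolP.
  exact: ideal_down (mvdist_trans _ _ _) (idealD xy yz).
Qed.

Canonical ideal_equiv := EquivRelPack ideal_rel_equiv.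

Definition mv_quot : Type := {eq_quot ideal_equiv}.

Definition quot_proj (x : B) : mv_quot := \pi_({eq_quot ideal_equiv}) (x : {classic B}).
Definition quot_repr (u : mv_quot) : B := repr (u : {eq_quot ideal_equiv}).

Lemma quot_reprK u : quot_proj (quot_repr u) = u.
Proof. exact: reprK. Qed.

Lemma quot_projP x y : quot_proj x = quot_proj y <-> ideal_set I (mvdist x y).
Proof.
by split=> [/eqquotP/asboolP|h]; [|apply/eqquotP/asboolP].
Qed.

Lemma quot_repr_proj x : ideal_set I (mvdist (quot_repr (quot_proj x)) x).
Proof. by apply/quot_projP; rewrite quot_reprK. Qed.

Definition quot0 : mv_quot := quot_proj mv0.
Definition quot_add (u v : mv_quot) : mv_quot :=
  quot_proj (quot_repr u ⊕ quot_repr v).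
Definition quot_neg (u : mv_quot) : mv_quot := quot_proj (¬ quot_repr u).

Lemma quot_addE x y : quot_add (quot_proj x) (quot_proj y) = quot_proj (x ⊕ y).
Proof.
apply/quot_projP; apply: ideal_down (mvdist_add _ _ _ _) _.
by apply: idealD; exact: quot_repr_proj.
Qed.

Lemma quot_negE x : quot_neg (quot_proj x) = quot_proj (¬ x).
Proof. by apply/quot_projP; rewrite mvdistNN; exact: quot_repr_proj. Qed.

Lemma quot_ind (P : mv_quot -> Prop) : (forall x, P (quot_proj x)) -> forall u, P u.
Proof. by move=> h u; rewrite -(quot_reprK u). Qed.

Lemma quot_addA : associative quot_add.
Proof.
elim/quot_ind=> x; elim/quot_ind=> y; elim/quot_ind=> z.
by rewrite !quot_addE mvaddA.
Qed.
Lemma quot_addC : commutative quot_add.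
Proof. by elim/quot_ind=> x; elim/quot_ind=> y; rewrite !quot_addE mvaddC. Qed.
Lemma quot_addx0 : right_id quot0 quot_add.
Proof. by elim/quot_ind=> x; rewrite quot_addE mvadd0. Qed.
Lemma quot_negK : involutive quot_neg.
Proof. by elim/quot_ind=> x; rewrite !quot_negE mvnegK. Qed.
Lemma quot_addx1 u : quot_add u (quot_neg quot0) = quot_neg quot0.
Proof. by elim/quot_ind: u => x; rewrite quot_negE quot_addE mvadd1. Qed.
Lemma quot_maxC u v : quot_add (quot_neg (quot_add (quot_neg u) v)) v =
                      quot_add (quot_neg (quot_add (quot_neg v) u)) u.
Proof.
elim/quot_ind: u => x; elim/quot_ind: v => y.
by rewrite !(quot_negE, quot_addE) mvmaxC.
Qed.

HB.instance Definition _ := isMVAlgebra.Build mv_quot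
  quot_addA quot_addC quot_addx0 quot_negK quot_addx1 quot_maxC.

Lemma quot_proj_morph : mv_morphism quot_proj.
Proof.
by split=> [//|x y|x]; [rewrite -quot_addE | rewrite -quot_negE].
Qed.

End Quotient.

Section QuotientMap.
Variable B : mvAlgType.
Implicit Types I J : mv_ideal B.

Definition quot_map I J (JI : J `<=` I) (u : mv_quot J) : mv_quot I :=
  quot_proj I (quot_repr u).

Lemma quot_mapE I J (JI : J `<=` I) x :
  quot_map JI (quot_proj J x) = quot_proj I x.
Proof. by apply/quot_projP/JI; exact: quot_repr_proj. Qed.

Lemma quot_map_morph I J (JI : J `<=` I) : mv_morphism (quot_map JI).
Proof.
have [p0 pD pN] := quot_proj_morph I; have [q0 qD qN] := quot_proj_morph J.
split=> [|u v|u]; first by rewrite -q0 quot_mapE p0.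
- elim/quot_ind: u => x; elim/quot_ind: v => y.
  by rewrite -qD !quot_mapE pD.
- by elim/quot_ind: u => x; rewrite -qN !quot_mapE pN.
Qed.

Definition fin_ideal : Type := {I : mv_ideal B | mv_finite (mv_quot I)}.

Definition fin_ideal_le (I J : fin_ideal) : Prop :=
  proj1_sig J `<=` proj1_sig I.

Lemma idealT_down (x y : B) : x ≤ y -> [set: B] y -> [set: B] x.
Proof. by []. Qed.

Definition idealT : mv_ideal B :=
  @MVIdeal B [set: B] Logic.I (fun _ _ _ _ => Logic.I) idealT_down.

Lemma idealT_fin : mv_finite (mv_quot idealT).
Proof.
apply: (@sub_finite_set _ _ [set mv0]); last exact: finite_set1.
by elim/quot_ind=> x _; exact/quot_projP.
Qed.

Section Inter.
Variables I J : mv_ideal B.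

Lemma idealI0 : (I `&` J) mv0. Proof. by split; exact: ideal0. Qed.

Lemma idealID x y : (I `&` J) x -> (I `&` J) y -> (I `&` J) (x ⊕ y).
Proof. by move=> [? ?] [? ?]; split; exact: idealD. Qed.

Lemma idealI_down x y : x ≤ y -> (I `&` J) y -> (I `&` J) x.
Proof. by move=> xy [? ?]; split; apply: (ideal_down xy). Qed.

Definition idealI : mv_ideal B := MVIdeal idealI0 idealID idealI_down.

Lemma idealI_fin :
  mv_finite (mv_quot I) -> mv_finite (mv_quot J) -> mv_finite (mv_quot idealI).
Proof.
move=> fI fJ.
pose f (u : mv_quot idealI) := (quot_map (@subIsetl _ I J : idealI `<=` I) u,
                                quot_map (@subIsetr _ I J : idealI `<=` J) u).
have f_inj : injective f.
  elim/quot_ind=> x; elim/quot_ind=> y; rewrite /f !quot_mapE => -[].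
  by move=> /quot_projP hI /quot_projP hJ; apply/quot_projP.
have: finite_set (f @^-1` ([set: mv_quot I] `*` [set: mv_quot J])).
  by apply: finite_preimage; [move=> ? ? _ _; exact: f_inj | exact: finite_setX].
by apply: sub_finite_set.
Qed.

End Inter.

Lemma fin_ideal_directed (I J : fin_ideal) :
  exists2 K, fin_ideal_le I K & fin_ideal_le J K.
Proof.
case: I J => [I fI] [J fJ].
by exists (exist _ (idealI I J) (idealI_fin fI fJ)) => x [].
Qed.

Lemma fin_ideal_le_trans (I J K : fin_ideal) :
  fin_ideal_le I J -> fin_ideal_le J K -> fin_ideal_le I K.
Proof. by move=> h1 h2 x /h2/h1. Qed.

Lemma quot_map_id (I : fin_ideal) (ii : fin_ideal_le I I) u : quot_map ii u = u.
Proof. by elim/quot_ind: u => x; rewrite quot_mapE. Qed.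

Lemma quot_map_comp (I J K : fin_ideal) (ij : fin_ideal_le I J)
    (jk : fin_ideal_le J K) (ik : fin_ideal_le I K) u :
  quot_map ij (quot_map jk u) = quot_map ik u.
Proof. by elim/quot_ind: u => x; rewrite !quot_mapE. Qed.

Definition fin_quotient_system : inverse_system :=
  @InverseSystem fin_ideal fin_ideal_le
    (fun I : fin_ideal => @subset_refl _ (proj1_sig I : set B)) fin_ideal_le_trans
    (inhabits (exist _ idealT idealT_fin)) fin_ideal_directed
    (fun I : fin_ideal => mv_quot (proj1_sig I))
    (fun (I J : fin_ideal) (IJ : fin_ideal_le I J) => quot_map IJ)
    (fun (I J : fin_ideal) (IJ : fin_ideal_le I J) => quot_map_morph IJ) quot_map_id quot_map_comp.

Definition profinite_completion : mvAlgType := inverse_limit fin_quotient_system.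

End QuotientMap.

(* Main.v *)
(* Choose in each fibre of n a base point, and let B be the algebra of those
   f in the product which, on each fibre, equal their value at the base point
   up to finitely many exceptions.  The base point of an infinite fibre plays
   the role of its point at infinity, so no new maximal ideal of finite rank
   appears there.  If B/I is finite, then two of the elements obtained by
   rounding 2^-i down to the chains, i = 0, 1, ..., agree modulo I; their
   difference dominates one of them, and a multiple of that one is 1 wherever n
   is large.  So I contains the indicator function of {x | n x > M} for some M,
   i.e. no finite quotient of B sees the region where n is unbounded.
   Likewise I contains all but finitely many of the one-point indicators, hence
   all functions of B vanishing on a suitable finite set.  As B maps onto every
   finite subproduct, its completion is the whole product. *)
Require Import Defs.
From HB Require Import structures.
From mathcomp Require Import all_boot all_order all_algebra.
From mathcomp Require Import boolp classical_sets cardinality.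
From mathcomp Require Import lra.

Import Order.TTheory GRing.Theory Num.Theory.
Local Open Scope mv_scope.
Local Open Scope classical_set_scope.

Set Implicit Arguments.
Unset Strict Implicit.
Unset Printing Implicit Defensive.

(** * Distance, morphisms and kernels in MV-algebras *)

Section MVFacts.
Variable A : mvAlgType.
Implicit Types x y : A.

Lemma mvle0x x : mv0 ≤ x.
Proof. by rewrite /mvle mvadd1l. Qed.

Lemma mvlex1 x : x ≤ ¬ mv0.
Proof. by rewrite /mvle mvadd1. Qed.

Lemma mvle_addl x y : x ≤ y ⊕ x.
Proof. by rewrite mvaddC; exact: mvle_addr. Qed.

Lemma mvlex0 x : x ≤ mv0 -> x = mv0.
Proof. by rewrite /mvle mvadd0 => h; rewrite -(mvnegK x) h mvnegK. Qed.

Lemma mvsub0 x : x ⊖ mv0 = x.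
Proof. by rewrite /mvsub mvadd0 mvnegK. Qed.

Lemma mvdist_eq0 x y : mvdist x y = mv0 -> x = y.
Proof.
move=> d0.
have xy0 : x ⊖ y = mv0 by apply: mvlex0; rewrite -d0; exact: mvle_addr.
have yx0 : y ⊖ x = mv0 by apply: mvlex0; rewrite -d0; exact: mvle_addl.
have xy : x ≤ y by rewrite /mvle -[_ ⊕ _]mvnegK -/(x ⊖ y) xy0.
by rewrite -(mvsubK xy) yx0 mvadd0l.
Qed.

End MVFacts.

Section Morphisms.
Variables A B C : mvAlgType.

Lemma mv_morphism_dist (f : A -> B) : mv_morphism f ->
  forall x y, f (mvdist x y) = mvdist (f x) (f y).
Proof. by case=> _ fD fN x y; rewrite /mvdist /mvsub !(fD, fN). Qed.

Lemma mv_iso_trans : A ≅ B -> B ≅ C -> A ≅ C.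
Proof.
move=> [f [f0 fD fN] fbij] [g [g0 gD gN] gbij].
exists (g \o f); last exact: bij_comp.
split=> [|x y|x] /=; first by rewrite f0 g0.
- by rewrite fD gD.
- by rewrite fN gN.
Qed.

End Morphisms.

Section Kernel.
Variables (A B : mvAlgType) (f : A -> B) (f_morph : mv_morphism f).

Let ker : set A := [set x | f x = mv0].

Let ker0 : ker mv0. Proof. by case: f_morph. Qed.

Let kerD x y : ker x -> ker y -> ker (x ⊕ y).
Proof. by case: f_morph => _ fD _; rewrite /ker /= fD => -> ->; exact: mvadd0. Qed.

Let ker_down x y : x ≤ y -> ker y -> ker x.
Proof.
case: f_morph => f0 fD fN; rewrite /mvle /ker /= => xy y0.
by apply: mvlex0; rewrite /mvle -y0 -fN -fD xy fN f0 y0.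
Qed.

Definition mv_ker : mv_ideal A := MVIdeal ker0 kerD ker_down.

Lemma mv_ker_projP x y : quot_proj mv_ker x = quot_proj mv_ker y <-> f x = f y.
Proof.
rewrite quot_projP /= /ker /= mv_morphism_dist //.
by split=> [/mvdist_eq0|->] //; exact: mvdistxx.
Qed.

Lemma mv_ker_fin : mv_finite B -> mv_finite (mv_quot mv_ker).
Proof.
move=> finB; pose h u := f (quot_repr (I := mv_ker) u).
apply: (@sub_finite_set _ _ (h @^-1` [set: B])) => //.
apply: finite_preimage finB => u v _ _ /mv_ker_projP.
by rewrite !quot_reprK.
Qed.

End Kernel.

(** * Completions of algebras with dense image in a product of finite algebras *)

Section DenseSubalgebra.
Variables (X : eqType) (L : X -> mvAlgType) (B : mvAlgType).
Variable p : forall x, B -> L x.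
Hypothesis L_fin : forall x, mv_finite (L x).
Hypothesis p_morph : forall x, mv_morphism (@p x).
Hypothesis dense : forall (F : seq X) (g : mv_prod L),
  exists b : B, forall x, x \in F -> p x b = g x.
Hypothesis fin_ideal_support : forall I : mv_ideal B, mv_finite (mv_quot I) ->
  exists F : seq X, forall b, (forall x, x \in F -> p x b = mv0) -> ideal_set I b.

Let K x : fin_ideal B := exist _ (mv_ker (p_morph x)) (mv_ker_fin (p_morph x) (@L_fin x)).

(** The joint kernel of the coordinates in [F], folded from binary intersections so that finiteness
    of the quotient is carried along. By [fin_ideal_support] these ideals are cofinal among those
    with finite quotient. *)
Let KF (F : seq X) : fin_ideal B :=
  foldr (fun x J => exist _ (idealI (sval (K x)) (sval J))
    (idealI_fin (proj2_sig (K x)) (proj2_sig J)))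
    (exist _ (idealT B) (idealT_fin B)) F.

Let KF_P F b : ideal_set (sval (KF F)) b <-> (forall x, x \in F -> p x b = mv0).
Proof.
elim: F => [|x F IH] /=; first by split.
split=> [[bx /IH bF] y|bF].
  by rewrite in_cons => /orP[/eqP->|] //; exact: bF.
split; first by apply: bF; rewrite mem_head.
by apply/IH => y yF; apply: bF; rewrite in_cons yF orbT.
Qed.

Let support (I : fin_ideal B) : seq X := sval (cid (fin_ideal_support (proj2_sig I))).

Let supportP (I : fin_ideal B) : fin_ideal_le I (KF (support I)).
Proof.
by move=> b /KF_P; rewrite /support; case: cid => /= F; apply.
Qed.

Let approx (F : seq X) (g : mv_prod L) : B := sval (cid (dense F g)).

Let approxP F g x : x \in F -> p x (approx F g) = g x.
Proof. by rewrite /approx; case: cid => /= b; apply. Qed.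

Let proj_eq (I : fin_ideal B) b c :
  (forall x, x \in support I -> p x b = p x c) ->
  quot_proj (sval I) b = quot_proj (sval I) c.
Proof.
move=> bc; apply/quot_projP/supportP/KF_P => x xF.
by rewrite mv_morphism_dist // bc // mvdistxx.
Qed.

(** The choice made by [approx] is immaterial: elements agreeing on [support I] have the same class
    modulo [I]. *)
Let phi_fun (g : mv_prod L) : mv_prod (@is_obj (fin_quotient_system B)) :=
  fun I : fin_ideal B => quot_proj (sval I) (approx (support I) g).

Let phi_funE g (I : fin_ideal B) b :
  (forall x, x \in support I -> p x b = g x) ->
  phi_fun g I = quot_proj (sval I) b.
Proof. by move=> bg; apply: proj_eq => x xI; rewrite approxP // bg. Qed.

Let phi_coherent g : coherent (phi_fun g).
Proof.
(* One element matching [g] on both supports represents both components. *)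
move=> I J IJ; pose b := approx (support I ++ support J) g.
have bE x : (x \in support I) || (x \in support J) -> p x b = g x.
  by rewrite -mem_cat => xIJ; exact: approxP.
rewrite (@phi_funE g J b); last by move=> x xJ; rewrite bE // xJ orbT.
rewrite (@phi_funE g I b); last by move=> x xI; rewrite bE // xI.
exact: quot_mapE.
Qed.

Let phi g : profinite_completion B := exist _ _ (phi_coherent g).

Let comp (u : profinite_completion B) (I : fin_ideal B) : mv_quot (sval I) :=
  sval u I.

(** [p x] factors through the quotient by its own kernel [K x], so that component of [u] determines
    the coordinate at [x]. *)
Let psi (u : profinite_completion B) : mv_prod L :=
  fun x => p x (quot_repr (comp u (K x))).

Let psiE u x b : comp u (K x) = quot_proj (sval (K x)) b -> psi u x = p x b.
Proof.
by rewrite /psi => uE; apply/(mv_ker_projP (p_morph x)); rewrite quot_reprK.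
Qed.

Let phi_morph : mv_morphism phi.
Proof.
have pD x : {morph p x : b c / b ⊕ c} by case: (p_morph x).
have pN x : {morph p x : b / ¬ b} by case: (p_morph x).
have p0 x : p x mv0 = mv0 by case: (p_morph x).
split=> [|g h|g]; apply: lim_inj; apply: functional_extensionality_dep => I.
- by apply: (@phi_funE _ I mv0) => x _; rewrite p0.
- have [_ qD _] := quot_proj_morph (sval I).
  apply: etrans (qD _ _); apply: (@phi_funE _ I) => x xI.
  by rewrite pD !approxP.
- have [_ _ qN] := quot_proj_morph (sval I).
  apply: etrans (qN _); apply: (@phi_funE _ I) => x xI.
  by rewrite pN !approxP.
Qed.

Let phiK : cancel phi psi.
Proof.
move=> g; apply: functional_extensionality_dep => x.
(* [x] is prepended because [support (K x)] comes from a choice and is not known to contain it. *)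
have xE := @approxP (x :: support (K x)) g.
rewrite (@psiE _ x (approx (x :: support (K x)) g)); first by rewrite xE ?mem_head.
by apply: (@phi_funE g (K x)) => y yF; rewrite xE // in_cons yF orbT.
Qed.

Let psiK : cancel psi phi.
Proof.
move=> u; apply: lim_inj; apply: functional_extensionality_dep => I.
have uc (I' J : fin_ideal B) (IJ : fin_ideal_le I' J) :
    quot_map IJ (comp u J) = comp u I' by exact: (proj2_sig u I' J IJ).
(* [J] is contained in [I] and in each [K x] with [x] in [support I], so the single representative
   [b] computes all these components of [u]. *)
pose J := KF (support I); pose b := quot_repr (comp u J).
have uJ : comp u J = quot_proj (sval J) b by rewrite quot_reprK.
rewrite -[RHS](uc I J (@supportP I)) uJ.
apply: etrans (esym (quot_mapE _ _)).
apply: (@phi_funE _ I) => x xI; apply/esym/psiE.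
have JK : fin_ideal_le (K x) J by move=> c /KF_P; exact.
by rewrite -(uc (K x) J JK) uJ; exact: quot_mapE.
Qed.

Lemma prod_iso_profinite_completion : mv_prod L ≅ profinite_completion B.
Proof. by exists phi; [exact: phi_morph | exact: (Bijective phiK psiK)]. Qed.

End DenseSubalgebra.

(** * Subalgebras, finite sums and the pigeonhole principle for finite quotients *)

Section Subalgebra.
Variables (A : mvAlgType) (P : set A).
Hypotheses (P0 : P mv0) (PD : forall x y, P x -> P y -> P (x ⊕ y)).
Hypothesis PN : forall x, P x -> P (¬ x).

(** The closure proofs are parameters of the type, so that the algebra structure can be recovered
    from the type alone. *)
Definition mv_sub of P mv0 & (forall x y, P x -> P y -> P (x ⊕ y))
  & (forall x, P x -> P (¬ x)) : Type := {x : A | P x}.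

Let S := mv_sub P0 PD PN.

Lemma mv_sub_inj (x y : S) : sval x = sval y -> x = y.
Proof. exact: eq_sig_hprop (fun z => @Prop_irrelevance (P z)) x y. Qed.

Definition sub0 : S := exist _ mv0 P0.
Definition sub_add (x y : S) : S := exist _ _ (PD (proj2_sig x) (proj2_sig y)).
Definition sub_neg (x : S) : S := exist _ _ (PN (proj2_sig x)).

Lemma sub_addA : associative sub_add.
Proof. by move=> x y z; apply: mv_sub_inj; exact: mvaddA. Qed.
Lemma sub_addC : commutative sub_add.
Proof. by move=> x y; apply: mv_sub_inj; exact: mvaddC. Qed.
Lemma sub_addx0 : right_id sub0 sub_add.
Proof. by move=> x; apply: mv_sub_inj; exact: mvadd0. Qed.
Lemma sub_negK : involutive sub_neg.
Proof. by move=> x; apply: mv_sub_inj; exact: mvnegK. Qed.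
Lemma sub_addx1 x : sub_add x (sub_neg sub0) = sub_neg sub0.
Proof. by apply: mv_sub_inj; exact: mvadd1. Qed.
Lemma sub_maxC x y : sub_add (sub_neg (sub_add (sub_neg x) y)) y =
                     sub_add (sub_neg (sub_add (sub_neg y) x)) x.
Proof. by apply: mv_sub_inj; exact: mvmaxC. Qed.

HB.instance Definition _ := isMVAlgebra.Build (mv_sub P0 PD PN)
  sub_addA sub_addC sub_addx0 sub_negK sub_addx1 sub_maxC.

End Subalgebra.

Definition mv_sum (A : mvAlgType) (s : seq A) : A := foldr (@mvadd A) mv0 s.

Lemma mvle_sum (T : eqType) (B : mvAlgType) (h : T -> B) (s : seq T) a :
  a \in s -> h a ≤ mv_sum (map h s).
Proof.
elim: s => //= b s IH; rewrite in_cons => /orP[/eqP->|/IH as_]; first exact: mvle_addr.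
exact: mvle_trans as_ (mvle_addl _ _).
Qed.

Lemma ideal_sum (B : mvAlgType) (I : mv_ideal B) (T : eqType) (h : T -> B) (s : seq T) :
  (forall a, a \in s -> ideal_set I (h a)) -> ideal_set I (mv_sum (map h s)).
Proof.
elim: s => [_|a s IH hI] /=; first exact: ideal0.
apply: idealD; first by apply: hI; rewrite mem_head.
by apply: IH => b bs; apply: hI; rewrite in_cons bs orbT.
Qed.

Lemma finite_set_inj (T U : Type) (D : set T) (E : set U) (h : T -> U) :
  finite_set E -> (forall a, D a -> E (h a)) ->
  (forall a b, D a -> D b -> h a = h b -> a = b) -> finite_set D.
Proof.
move=> fE DE h_inj.
have h_inj_in : {in D &, injective h} by move=> a b /set_mem Da /set_mem Db; exact: h_inj.
rewrite -(eq_finite_set (inj_card_eq h_inj_in)).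
by apply: sub_finite_set fE => _ [a Da <-]; exact: DE.
Qed.

Lemma finite_quot_pigeonhole (B : mvAlgType) (I : mv_ideal B) (T : Type) (D : set T)
    (h : T -> B) : mv_finite (mv_quot I) ->
  (forall a b, D a -> D b -> ideal_set I (mvdist (h a) (h b)) -> a = b) ->
  finite_set D.
Proof.
move=> I_fin h_inj.
apply: (finite_set_inj (h := fun a => quot_proj I (h a)) I_fin) => // a b Da Db.
by move=> /quot_projP; exact: h_inj.
Qed.

(** * Order and truncated sums in the chains *)

Section LukasiewiczOrder.
Local Open Scope ring_scope.
Variables (n : nat) (n_ge2 : (2 <= n)%N).
Implicit Types x y : luk n_ge2.

Definition Luk (q : rat) (Lq : q \in luk_carrier n) : luk n_ge2 := exist _ q Lq.

Lemma luk_val_itv x : 0 <= sval x <= 1.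
Proof. exact/(luk_carrier_itv n_ge2)/valP. Qed.

Lemma luk_finite : mv_finite (luk n_ge2).
Proof.
apply: (@sub_finite_set _ _ ((val : luk n_ge2 -> rat) @^-1` [set` luk_carrier n])).
  by move=> x _; exact: valP.
by apply: finite_preimage (finite_seq _) => x y _ _; exact: val_inj.
Qed.

Lemma luk_leP x y : x ≤ y <-> sval x <= sval y.
Proof.
rewrite /mvle; split=> [/(congr1 sval)|xy]; last apply: val_inj; rewrite /= subr0.
  by move=> /min_idPl; lra.
by apply/min_idPl; lra.
Qed.

Lemma luk_val_sub x y : sval (x ⊖ y) = Num.max 0 (sval x - sval y).
Proof.
have /andP[? ?] := luk_val_itv x; have /andP[? ?] := luk_val_itv y; rewrite /=.
by do 2?case: leP => ?; lra.
Qed.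

Lemma luk_val_sum k x : sval (mv_sum (nseq k x)) = Num.min 1 (k%:R * sval x).
Proof.
elim: k => [|k IH]; first by rewrite mul0r; case: leP => //; lra.
have /andP[? ?] := luk_val_itv x.
rewrite /= IH -natr1 mulrDl mul1r.
have : 0 <= k%:R * sval x by rewrite mulr_ge0.
move: (k%:R * sval x) => a a_ge0; rewrite addrC.
by case: (leP 1 a) => ?; do ![case: leP => ?]; lra.
Qed.

End LukasiewiczOrder.

(** * Functions almost constant on the fibres of [n] *)

Section TameFunctions.
Variables (X : choiceType) (n : X -> nat) (n_ge2 : forall x, 2 <= n x).
Let L x : mvAlgType := luk (n_ge2 x).
Let P : mvAlgType := mv_prod L.

Let fiber_ex x : exists y, n y == n x := ex_intro _ x (eqxx (n x)).

(** [xchoose] depends only on the predicate [n y == n x], so all points of a fibre share one base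
    point. *)
Definition base (x : X) : X := xchoose (fiber_ex x).

Lemma n_base x : n (base x) = n x.
Proof. exact/eqP/(xchooseP (fiber_ex x)). Qed.

Lemma eq_base x y : n x = n y -> base x = base y.
Proof. by move=> nxy; apply: eq_xchoose => z; rewrite nxy. Qed.

Lemma baseK x : base (base x) = base x.
Proof. exact/eq_base/n_base. Qed.

(** Values are compared as rationals because [L x] and [L (base x)] are different types. *)
Definition jump_set (f : P) (m : nat) : set X :=
  [set x | n x = m /\ sval (f x) <> sval (f (base x))].

Definition tame : set P := [set f | forall m, finite_set (jump_set f m)].

Lemma tame_sub (f : P) (F : set X) : finite_set F ->
  (forall x, ~ F x -> sval (f x) = sval (f (base x))) -> tame f.
Proof.
move=> finF fF m; apply: sub_finite_set finF => x [_ fx].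
by apply: contrapT => /fF.
Qed.

Lemma tame0 : tame mv0.
Proof. exact: (@tame_sub _ set0). Qed.

Lemma tameD f g : tame f -> tame g -> tame (f ⊕ g).
Proof.
move=> tf tg m; have finF := tf m; have finG := tg m.
apply: (@sub_finite_set _ _ (jump_set f m `|` jump_set g m)); last by rewrite finite_setU.
move=> x [nx fgx]; apply: contrapT => /not_orP[nf ng]; apply: fgx.
have fE : sval (f x) = sval (f (base x)) by apply: contrapT => h; apply: nf.
have gE : sval (g x) = sval (g (base x)) by apply: contrapT => h; apply: ng.
by rewrite /= fE gE.
Qed.

Lemma tameN f : tame f -> tame (¬ f).
Proof.
move=> tf m; apply: sub_finite_set (tf m) => x [nx fx]; split=> // fE.
by apply: fx; rewrite /= fE.
Qed.

Definition tame_alg : mvAlgType := mv_sub tame0 tameD tameN.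

Definition tame_ev x (f : tame_alg) : L x := sval f x.

Lemma tame_ev_morph x : mv_morphism (@tame_ev x).
Proof. by split. Qed.

Lemma tame_leP (f g : tame_alg) : (forall x, tame_ev x f ≤ tame_ev x g) -> f ≤ g.
Proof.
move=> fg; apply: mv_sub_inj; apply: functional_extensionality_dep => x.
exact: fg.
Qed.

Lemma tame_dense (F : seq X) (g : P) :
  exists f : tame_alg, forall x, x \in F -> tame_ev x f = g x.
Proof.
have gb x : sval (g (base x)) \in luk_carrier (n x).
  by rewrite -(n_base x); exact: valP.
(* Off [F] the value of [g] at the base point is copied, which [n_base] places in the right chain;
   jumps then occur only inside [F]. *)
pose f : P := fun x => if x \in F then g x else Luk _ (gb x).
have fb x : sval (f (base x)) = sval (g (base x)).
  by rewrite /f; case: ifP => // _; rewrite /= baseK.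
have tf : tame f.
  apply: (@tame_sub _ [set` F]); first exact: finite_seq.
  by move=> x /negP xF; rewrite fb /f (negbTE xF).
by exists (exist _ f tf) => x xF; rewrite /tame_ev /= /f xF.
Qed.

(* Zero when x is a base point, whose indicator need not be tame. *)
Definition point_fun (x : X) : P :=
  fun y => if (y == x) && (base x != x) then ¬ mv0 else mv0.

Lemma point_fun_tame x : tame (point_fun x).
Proof.
(* For [y] other than [x], a nonzero value at [base y] would need [base y = x], making [x] a base
   point. *)
apply: (@tame_sub _ [set x]) => // y /eqP yx; rewrite /point_fun (negbTE yx) /=.
case: ifP => // /andP[/eqP yb /eqP]; case.
by rewrite -yb baseK.
Qed.

Definition point (x : X) : tame_alg := exist _ _ (point_fun_tame x).

Lemma tame_ev_point x y :
  tame_ev y (point x) = if (y == x) && (base x != x) then ¬ mv0 else mv0.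
Proof. by []. Qed.

Local Open Scope ring_scope.

Lemma scale_funP j x : ((n x).-1 %/ 2 ^ j)%:R / (n x).-1%:R \in luk_carrier (n x).
Proof.
apply/(luk_carrierP (n_ge2 x)); exists ((n x).-1 %/ 2 ^ j)%N => //.
exact: leq_div.
Qed.

(* Rounds the constant 2^-j down to the chains [L x]. *)
Definition scale_fun j : P := fun x => Luk _ (scale_funP j x).

Lemma scale_fun_tame j : tame (scale_fun j).
Proof. by apply: (@tame_sub _ set0) => // x _; rewrite /= n_base. Qed.

Definition scale j : tame_alg := exist _ _ (scale_fun_tame j).

(** With [m = n x - 1], twice the floor of [m / 2^j] is at most the floor of [m / 2^i], so
    [scale i ⊖ scale j] already dominates [scale j]. *)
Lemma scale_le_dist i j : (i < j)%N -> scale j ≤ mvdist (scale i) (scale j).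
Proof.
move=> ij; apply: (mvle_trans _ (mvle_addr _ _)); apply: tame_leP => x.
apply/luk_leP.
have -> : tame_ev x (scale i ⊖ scale j) = tame_ev x (scale i) ⊖ tame_ev x (scale j) by [].
rewrite luk_val_sub; set a := sval _; set b := sval _.
suff : a + a <= b by rewrite le_max; lra.
rewrite /a /b /= -mulrDl -natrD ler_wpM2r ?invr_ge0 // ler_nat addnn -muln2.
apply: (@leq_trans ((n x).-1 %/ 2 ^ i.+1 * 2)).
  by rewrite leq_mul2r /= leq_div2l ?expn_gt0 // leq_exp2l.
by rewrite expnSr divnMA leq_trunc_div.
Qed.

(** Write [m = n x - 1 = q 2^j + r]. The hypothesis gives [q >= 1], so [r < 2^j <= q 2^j] and
    [m <= 2^(j+1) q]: the extra factor 2 absorbs the remainder. *)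
Lemma scale_sum j x : (2 ^ j < n x)%N ->
  tame_ev x (mv_sum (nseq (2 ^ j.+1) (scale j))) = ¬ mv0.
Proof.
move=> jx.
have -> k : tame_ev x (mv_sum (nseq k (scale j))) = mv_sum (nseq k (tame_ev x (scale j))).
  by elim: k => //= k <-.
apply: val_inj; rewrite /= luk_val_sum /= subr0; apply/min_idPl.
set m := (n x).-1; have m_gt0 : (0 < m)%N by rewrite /m; case: (n x) (n_ge2 x) => [|[]].
have jm : (2 ^ j <= m)%N by move: jx; rewrite /m; case: (n x).
rewrite mulrA ler_pdivlMr ?ltr0n // mul1r -natrM ler_nat.
rewrite {1}(divn_eq m (2 ^ j)) expnS -mulnA mul2n -addnn mulnC leq_add2l.
apply: ltnW; apply: (leq_trans (ltn_pmod _ _)); first by rewrite expn_gt0.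
by rewrite leq_pmulr // divn_gt0 // expn_gt0.
Qed.

Local Close Scope ring_scope.

(** * Ideals of the tame algebra with finite quotient *)

Section FiniteQuotient.
Variables (I : mv_ideal (tame_alg)) (I_fin : mv_finite (mv_quot I)).

(** Otherwise, by [scale_le_dist], the scales would lie in infinitely many distinct classes. *)
Lemma ideal_scale : exists j, ideal_set I (scale j).
Proof.
apply: contrapT => noI; apply: infinite_nat.
apply: (finite_quot_pigeonhole (h := scale) I_fin) => i j _ _ dij.
by case: (ltngtP i j) => // ij; exfalso; apply: noI; [exists j|exists i];
  apply: ideal_down (scale_le_dist ij) _; rewrite // mvdistC.
Qed.

(** For distinct [x] and [y], [point x ⊖ point y] dominates [point x], so a congruence between the
    two puts [point x] in [I]. *)
Lemma finite_points_notin : finite_set [set x | ~ ideal_set I (point x)].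
Proof.
apply: (finite_quot_pigeonhole (h := point) I_fin) => x y /= nIx _ dxy.
apply: contrapT => xy; apply: nIx; apply: ideal_down dxy.
apply: (mvle_trans _ (mvle_addr _ _)); apply: tame_leP => z.
have -> : tame_ev z (point x ⊖ point y) = tame_ev z (point x) ⊖ tame_ev z (point y) by [].
rewrite !tame_ev_point; case: (eqVneq z x) => [->|_]; last exact: mvle0x.
by rewrite (negbTE (introN eqP xy)) mvsub0 /mvle mvaddN.
Qed.

Lemma finite_base_le M : finite_set [set x | base x = x /\ n x <= M].
Proof.
apply: (finite_set_inj (h := n) (finite_II M.+1)) => [x [_ xM] //|x y [bx _] [b_y _] nxy].
by rewrite -bx -b_y; exact: eq_base.
Qed.

Lemma tame_fin_ideal_support :
  exists F : seq X, forall f : tame_alg,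
    (forall x, x \in F -> tame_ev x f = mv0) -> ideal_set I f.
Proof.
have [j Ij] := ideal_scale.
(* The base points in [F] make the reference value of [f] zero on every fibre with [n <= 2^j]; they
   are finitely many since [n] is injective on base points. *)
have [F FE] : exists F : seq X, [set x | ~ ideal_set I (point x)] `|`
    [set x | base x = x /\ n x <= 2 ^ j] = [set` F].
  by apply/finite_seqP; rewrite finite_setU; split;
    [exact: finite_points_notin | exact: finite_base_le].
exists F => f fF.
have f0 x : ~ ideal_set I (point x) \/ base x = x /\ n x <= 2 ^ j -> tame_ev x f = mv0.
  by move=> xF; apply: fF; have : [set` F] x by rewrite -FE.
(* Every point of [supp] is a jump of [f], in one of the finitely many fibres with [n <= 2^j], so
   tameness makes [supp] finite. *)
pose supp := [set x | n x <= 2 ^ j /\ tame_ev x f <> mv0].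
have [S SE] : exists S : seq X, supp = [set` S].
  apply/finite_seqP; apply: (@sub_finite_set _ _
    (\bigcup_(m in [set m | m < (2 ^ j).+1]) jump_set (sval f) m)).
    move=> x [xj fx]; exists (n x) => //; split=> // fxb; apply: fx.
    have fb : tame_ev (base x) f = mv0 by apply: f0; right; rewrite baseK n_base.
    by apply: val_inj; rewrite [LHS]fxb -/(tame_ev (base x) f) fb.
  by apply: bigcup_finite => [|m _]; [exact: finite_II | exact: (proj2_sig f)].
have SI x : x \in S -> ideal_set I (point x).
  move=> xS; have [_ fx] : supp x by rewrite SE.
  by apply: contrapT => Ix; apply: fx; apply: f0; left.
(* The first summand is 1 where [n x > 2^j], the second is 1 on [supp], and [f] vanishes
   elsewhere. *)
pose w := mv_sum (nseq (2 ^ j.+1) (scale j)) ⊕ mv_sum (map point S).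
apply: (@ideal_down _ I f w).
  apply: tame_leP => x.
  have -> : tame_ev x w = tame_ev x (mv_sum (nseq (2 ^ j.+1) (scale j)))
    ⊕ tame_ev x (mv_sum (map point S)) by [].
  case: (ltnP (2 ^ j) (n x)) => jx; first by rewrite scale_sum // mvadd1l; exact: mvlex1.
  have [->|fx] := pselect (tame_ev x f = mv0); first exact: mvle0x.
  have xS : x \in S by have : supp x by []; rewrite SE.
  have bx : base x != x by apply/eqP => bx; apply: fx; apply: f0; right.
  apply: mvle_trans (mvle_addl _ _).
  (* The order is an equation, so it can be evaluated at [x]; since [point x] is 1 there, it forces
     the sum to be 1. *)
  have /(congr1 (@tame_ev x)) := mvle_sum point xS.
  have -> : tame_ev x (¬ point x ⊕ mv_sum (map point S)) =
    ¬ tame_ev x (point x) ⊕ tame_ev x (mv_sum (map point S)) by [].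
  by rewrite tame_ev_point eqxx bx mvnegK mvadd0l => ->; exact: mvlex1.
apply: idealD; last exact: ideal_sum.
by elim: (2 ^ j.+1) => [|k IH]; [exact: ideal0 | exact: idealD].
Qed.

End FiniteQuotient.

End TameFunctions.

Lemma prod_luk_iso_profinite_completion (X : choiceType) (n : X -> nat)
    (n_ge2 : forall x, 2 <= n x) :
  mv_prod (fun x => luk (n_ge2 x)) ≅ profinite_completion (tame_alg n_ge2).
Proof.
apply: (@prod_iso_profinite_completion X _ _ (@tame_ev X n n_ge2)).
- by move=> x; exact: luk_finite.
- exact: tame_ev_morph.
- exact: tame_dense.
- exact: tame_fin_ideal_support.
Qed.

Theorem theorem3p3 (A : mvAlgType) (A_profinite : profinite A)
  (X : Type) (n : X -> nat) (n_ge2 : forall x, 2 <= n x)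
  (A_prod : mv_iso A (mv_prod (fun x => luk (n_ge2 x))))
  (n0_dvd : exists n0, eta_set n n0 /\
     finite_set [set m | eta_set n m /\ ~ (n0 - 1 %| m)]) :
  exists B : mvAlgType, mv_iso A (profinite_completion B).
Proof.
(* Classically [X] may be taken to be a choice type, as [xchoose] in [base] requires. *)
move: n n_ge2 A_prod {n0_dvd}; elim/Pchoice: X => X n n_ge2 A_prod.
exists (tame_alg n_ge2).
exact: mv_iso_trans A_prod (prod_luk_iso_profinite_completion n_ge2).
Qed.
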